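(* Let $X$ be a compact Hausdorff space and $\mathcal{Z}$ a disjoint family of nonempty nowhere dense zero-sets in $X$. For each $Z \in \mathcal{Z}$ let $f_Z \in D(X)$ satisfy $f_Z \geq 1$ and $f_Z^{-1}(+\infty)=Z$, let $S$ be the linear span of $\{f_Z \mid Z \in \mathcal{Z}\}$ in $D(X)$, and let $A(X,\mathcal{Z}) = C(X)+S$, with distinguished weak order unit the constant function $1$. If $X$ is $\pi$ZD and $\bigcup\mathcal{Z}$ is nowhere dense (e.g., $\mathcal{Z}$ is finite), then $A(X,\mathcal{Z})$ has SMP (sufficiently many projections).
   Context: For compact Hausdorff $X$, $D(X)$ is the set of continuous $f : X \to \mathbb{R} \cup \{\pm\infty\}$ with $f^{-1}(\mathbb{R})$ dense in $X$; it is a lattice under pointwise order, closed under multiplication by real scalars, with addition only partially defined: $f+g=h$ in $D(X)$ means $h \in D(X)$ and $h(x)=f(x)+g(x)$ on the dense set where $f$ and $g$ are both finite. The linear span $S$ is the set of all finite sums $\sum_{i\in I} r_i f_{Z_i}$ with $r_i \in \mathbb{R}$ and $Z_i \in \mathcal{Z}$ (which may be taken distinct, hence disjoint); these sums, and sums of their members with members of $C(X)$, exist in $D(X)$. $A(X,\mathcal{Z})$ is an archimedean vector lattice in $D(X)$ under these operations, with weak order unit $1$. A compact Hausdorff space $X$ is $\pi$ZD if every nonempty open subset of $X$ contains a nonempty clopen subset of $X$. A band in a vector lattice $A$ is an ideal closed under existing suprema of subsets of its elements; a projection band is a band $B$ for which $A = B \oplus B'$ for some band $B' \subseteq A$. $A$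 has sufficiently many projections (SMP) if each nonzero band contains a nonzero projection band. *)

(* Defs.v *)
From mathcomp Require Import all_boot all_order all_algebra.
From mathcomp Require Import all_classical all_reals all_analysis.
Import Order.TTheory GRing.Theory Num.Theory numFieldNormedType.Exports.

Set Implicit Arguments.
Unset Strict Implicit.
Unset Printing Implicit Defensive.

Local Open Scope classical_set_scope.
Local Open Scope ring_scope.
Local Open Scope ereal_scope.

Definition nowhere_dense (X : topologicalType) (E : set X) : Prop :=
  interior (closure E) = set0.

Definition zero_set (R : realType) (X : topologicalType) (E : set X) : Prop :=
  exists g : X -> R, continuous g /\ E = g @^-1` [set 0%R].

Definition piZD (X : topologicalType) : Prop :=
  forall U : set X, open U -> U !=set0 ->
    exists K : set X, [/\ clopen K, K !=set0 & K `<=` U].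

Section ExtendedFunctions.
Context {R : realType} {X : topologicalType}.
Implicit Types (f g h s t : X -> \bar R) (A B I F : set (X -> \bar R)).

Definition DX : set (X -> \bar R) :=
  [set f | continuous f /\ dense [set x | f x \is a fin_num]].

(* The partial addition of D(X): [Dsum f g h] is "f + g = h in D(X)". The
   library's pointwise [f \+ g] is not used because it sets +oo + -oo = -oo. *)
Definition Dsum f g h : Prop :=
  [/\ DX f, DX g, DX h &
      forall x, f x \is a fin_num -> g x \is a fin_num -> h x = f x + g x].

(* Since 0 * +oo = 0 * -oo = 0 in \bar R, [Dscale 0 f] is the zero function. *)
Definition Dscale (r : R) f : X -> \bar R := fun x => r%:E * f x.

Definition CX : set (X -> \bar R) :=
  [set h | exists g : X -> R, continuous g /\ h = EFin \o g].

(* The notions below are those of vector lattices, for a vector lattice [A] in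
   D(X): the sum is [Dsum], the order is pointwise, and so the absolute value
   f \/ (- f) is the pointwise one. *)

Definition vl_ideal A I : Prop :=
  [/\ I `<=` A,
      I (cst 0),
      forall f g h, I f -> I g -> Dsum f g h -> I h,
      forall (r : R) f, I f -> I (Dscale r f) &
      forall f g, I f -> A g -> (forall x, `|g x| <= `|f x|) -> I g].

Definition vl_sup A F s : Prop :=
  [/\ A s,
      forall f, F f -> forall x, f x <= s x &
      forall t, A t -> (forall f, F f -> forall x, f x <= t x) ->
        forall x, s x <= t x].

Definition vl_band A B : Prop :=
  vl_ideal A B /\ forall F s, F `<=` B -> vl_sup A F s -> B s.

Definition vl_direct_sum A B B' : Prop :=
  B `&` B' = [set cst 0] /\
  forall f, A f -> exists b b', [/\ B b, B' b' & Dsum b b' f].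

Definition projection_band A B : Prop :=
  vl_band A B /\ exists B', vl_band A B' /\ vl_direct_sum A B B'.

Definition vl_nonzero B : Prop := exists2 f, B f & f <> cst 0.

Definition SMP A : Prop :=
  forall B, vl_band A B -> vl_nonzero B ->
    exists P, [/\ projection_band A P, vl_nonzero P & P `<=` B].

(* [f] is only used at members of [ZZ]. A finite sum in D(X) is the member of
   D(X) that agrees with the pointwise sum wherever all the terms are finite. *)
Definition Dspan (ZZ : set (set X)) (f : set X -> X -> \bar R) :
    set (X -> \bar R) :=
  [set h | DX h /\
    exists (n : nat) (r : 'I_n -> R) (Z : 'I_n -> set X),
      (forall i, ZZ (Z i)) /\
      forall x, (forall i, f (Z i) x \is a fin_num) ->
        h x = \sum_(i < n) (r i)%:E * f (Z i) x].

(* A(X, ZZ) = C(X) + S *)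
Definition AXZ (ZZ : set (set X)) (f : set X -> X -> \bar R) :
    set (X -> \bar R) :=
  [set h | exists c s, [/\ CX c, Dspan ZZ f s & Dsum c s h]].

End ExtendedFunctions.

(* Main.v *)
(* Let B be a nonzero band and g <> 0 in B. As the closure N of the union of ZZ
   is nowhere dense, the cozero set of g minus N is a nonempty open set, hence
   contains a nonempty clopen K. Each h in A(X, ZZ) is finite off N, so its
   restriction to K, extended by 0, lies in C(X); hence A(X, ZZ) is the direct
   sum of its bands of elements supported in K and in the complement of K. By
   compactness h / g is bounded on K for h supported in K, so h lies in B. *)

Require Import Defs.
From mathcomp Require Import all_boot all_order all_algebra.
From mathcomp Require Import all_classical all_reals all_analysis.
Import Order.TTheory GRing.Theory Num.Theory numFieldNormedType.Exports.

Set Implicit Arguments.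
Unset Strict Implicit.
Unset Printing Implicit Defensive.

Local Open Scope classical_set_scope.
Local Open Scope ring_scope.
Local Open Scope ereal_scope.

(** * Dense sets *)

Lemma dense_setC_closure (X : topologicalType) (E : set X) :
  nowhere_dense E -> dense (~` closure E).
Proof.
move=> hE O [x Ox] oO; apply: contrapT => h.
have : interior (closure E) x.
  rewrite /interior /= nbhsE; exists O => // y Oy.
  by apply: contrapT => Ny; apply: h; exists y.
by rewrite hE.
Qed.

Lemma dense_sub (X : topologicalType) (D E : set X) :
  D `<=` E -> dense D -> dense E.
Proof.
move=> DE dD O O0 oO; have [x [Ox Dx]] := dD O O0 oO.
by exists x; split => //; exact: DE.
Qed.

(** Neighbourhoods of [u x] and [v x] pull back to a common neighbourhood of [x], which meets [D];
    so they intersect, and the Hausdorff property applies. *)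
Lemma eq_continuous_dense (X T : topologicalType) (u v : X -> T) (D : set X) :
  hausdorff_space T -> continuous u -> continuous v -> dense D ->
  {in D, u =1 v} -> u =1 v.
Proof.
move=> hT cu cv dD uv x; apply: hT => A B /cu uA /cv vB.
have : nbhs x ((u @^-1` A) `&` (v @^-1` B)) by exact: filterI.
rewrite nbhsE; case=> O [oO Ox] OAB.
have [y [Oy Dy]] := dD O (ex_intro _ x Ox) oO.
have [Ay By] := OAB y Oy.
by exists (u y); split => //; rewrite (uv y) ?inE.
Qed.

(** * Continuity of extended real functions, and D(X) *)

Section ExtendedFunctions.
Context {R : realType} {X : topologicalType}.
Implicit Types (h : X -> \bar R) (K : set X).

(** [K] and its complement are both open, so near each point only one piece matters. Continuity is
    asked of each piece on its own side only, since [fine \o h] can be discontinuous where [h] is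
    infinite. *)
Lemma continuous_glue (T : topologicalType) (u v : X -> T) K : clopen K ->
  {in K, forall x, u @ x --> u x} ->
  {in ~` K, forall x, v @ x --> v x} ->
  continuous (fun x => if x \in K then u x else v x).
Proof.
move=> [oK cK] cu cv x.
have [Kx|nKx] := boolP (x \in K).
- rewrite /continuous_at Kx.
  apply: cvg_trans (cu x Kx); apply: near_eq_cvg.
  apply: filterS (open_nbhs_nbhs (conj oK (set_mem Kx))) => y Ky.
  by rewrite mem_set.
- rewrite /continuous_at (negbTE nKx).
  have Kx : x \in ~` K by rewrite inE => /mem_set; rewrite (negbTE nKx).
  apply: cvg_trans (cv x Kx); apply: near_eq_cvg.
  have oKC : open (~` K) by exact: closed_openC.
  apply: filterS (open_nbhs_nbhs (conj oKC (set_mem Kx))) => y Ky.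
  by rewrite memNset.
Qed.

Lemma continuous_fine h x :
  h x \is a fin_num -> h @ x --> h x -> fine \o h @ x --> fine (h x).
Proof. by move=> hx ch; apply: fine_cvg; rewrite fineK. Qed.

Lemma continuous_EFin (u : X -> R) : continuous u -> continuous (EFin \o u).
Proof.
by move=> cu x; apply: cvg_EFin; [exact: nearW | exact: cu].
Qed.

Lemma CX_DX : CX `<=` @DX R X.
Proof.
move=> _ [g [cg ->]]; split; first exact: continuous_EFin.
by apply: (@dense_sub _ setT) => // O O0 _; rewrite setIT.
Qed.

Lemma CX_cst (r : R) : CX (EFin \o cst r : X -> \bar R).
Proof. by exists (cst r); split => //; exact: cst_continuous. Qed.

Lemma continuous_sume (I : Type) (s : seq I) (P : pred I) (g : I -> X -> \bar R) (x : X) :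
  (forall i, P i -> g i @ x --> g i x) ->
  (forall i, P i -> g i x \is a fin_num) ->
  \sum_(i <- s | P i) g i y @[y --> x] --> \sum_(i <- s | P i) g i x.
Proof.
move=> cg fg; elim: s => [|i s IH].
  rewrite [X in X @ _ --> _](_ : _ = cst 0); last by apply/funext => y; rewrite big_nil.
  by rewrite big_nil; exact: cvg_cst.
case: (boolP (P i)) => Pi; last first.
  rewrite [X in X @ _ --> _](_ : _ = fun y => \sum_(i <- s | P i) g i y); last first.
    by apply/funext => y; rewrite big_cons (negbTE Pi).
  by rewrite big_cons (negbTE Pi).
rewrite [X in X @ _ --> _](_ : _ = g i \+ fun y => \sum_(i <- s | P i) g i y); last first.
  by apply/funext => y; rewrite big_cons Pi.
rewrite big_cons Pi.
by apply: (cvgeD _ (cg i Pi) IH); rewrite fin_num_adde_defr // fg.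
Qed.

(* At most one term may be infinite at [x]: addition on \bar R is discontinuous
   at (+oo, -oo), where it takes the junk value -oo. *)
Lemma continuous_sume1 (I : finType) (g : I -> X -> \bar R) (x : X) :
  (forall i, g i @ x --> g i x) ->
  (forall i j, i != j -> g i x \is a fin_num \/ g j x \is a fin_num) ->
  \sum_i g i y @[y --> x] --> \sum_i g i x.
Proof.
move=> cg fg.
have [fx|] := pselect (forall i, g i x \is a fin_num).
  by apply: continuous_sume.
move=> /existsNP[j /negP gj].
have gi i : i != j -> g i x \is a fin_num.
  by move=> ij; case: (fg i j ij) => // h; rewrite h in gj.
rewrite [X in X @ _ --> _](_ : _ = g j \+ fun y => \sum_(i | i != j) g i y); last first.
  by apply/funext => y; rewrite (bigD1 j).
rewrite (bigD1 j) //=.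
have cO := continuous_sume (s := index_enum I) (fun i _ => cg i) gi.
apply: (cvgeD _ (cg j) cO).
by rewrite fin_num_adde_defl //; apply/sum_fin_numP => i _; exact: gi.
Qed.


Lemma DX_restrict (h1 h2 : X -> \bar R) : DX h1 -> continuous h2 ->
  (forall x, h1 x \is a fin_num -> h2 x \is a fin_num) -> DX h2.
Proof. by move=> [_ d1] c2 h12; split => //; apply: dense_sub d1. Qed.

Lemma DX_scale (r : R) h : DX h -> DX (Dscale r h).
Proof.
move=> hD; apply: (DX_restrict hD) => [x|x hx].
  by apply: cvgeZl => //; apply: (proj1 hD).
by rewrite /Dscale fin_numM.
Qed.

(** * The vector lattice A(X, ZZ) and its values off [N] *)

Section Space.
Context (ZZ : set (set X)) (f : set X -> X -> \bar R).
Hypotheses (hdisj : trivIset ZZ id)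
    (hfD : forall Z, ZZ Z -> DX (f Z))
    (hf1 : forall Z, ZZ Z -> forall x, 1 <= f Z x)
    (hfZ : forall Z, ZZ Z -> f Z @^-1` [set +oo] = Z)
    (hU : nowhere_dense (\bigcup_(Z in ZZ) Z)).

Let N := closure (\bigcup_(Z in ZZ) Z).

Lemma generator_fin_num Z x : ZZ Z -> ~ Z x -> f Z x \is a fin_num.
Proof.
move=> ZZZ Zx; have := hf1 ZZZ x; rewrite fin_numE.
by case E : (f Z x) => //= _; case: Zx; rewrite -(hfZ ZZZ).
Qed.

Lemma generator_fin_num_off Z x : ZZ Z -> ~ N x -> f Z x \is a fin_num.
Proof.
move=> ZZZ Nx; apply: generator_fin_num => // Zx; apply: Nx.
by apply: subset_closure; exists Z.
Qed.

(** Used in [AXZ_offE] to turn a formula valid off [N] into an actual element of the span. *)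
Lemma exists_Dspan n (r : 'I_n -> R) (Z : 'I_n -> set X) :
  (forall i, ZZ (Z i)) ->
  exists s, DX s /\
    forall x, (forall i, f (Z i) x \is a fin_num) ->
      s x = \sum_(i < n) (r i)%:E * f (Z i) x.
Proof.
move=> ZZZ.
(* Repeated sets are merged: [p i] is a representative of the indices [j] with
   [Z j = Z i]. By disjointness, at each point at most one merged term with a
   nonzero coefficient is infinite, so the merged sum is continuous. *)
pose p i : 'I_n := odflt i [pick j | Z j == Z i].
have Zp i : Z (p i) = Z i.
  by rewrite /p; case: pickP => [j /eqP|].
have pE i j : Z i = Z j -> p i = p j.
  (* The two picks agree but their defaults differ; the default is never taken. *)
  rewrite /p => ->; case: pickP => // /(_ j); by rewrite eqxx.
have sumE x : (forall i, f (Z i) x \is a fin_num) ->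
    \sum_(i < n) (r i)%:E * f (Z i) x =
    \sum_(j < n) (\sum_(i < n | p i == j) r i)%:E * f (Z j) x.
  move=> fx; rewrite (partition_big p predT) //=; apply: eq_bigr => j _.
  have -> : f (Z j) x = (fine (f (Z j) x))%:E by rewrite fineK.
  rewrite -EFinM mulr_suml -sumEFin; apply: eq_bigr => i /eqP ij.
  by rewrite EFinM fineK // -ij Zp.
pose s x := \sum_(j < n) (\sum_(i < n | p i == j) r i)%:E * f (Z j) x.
have sfin x : (forall i, f (Z i) x \is a fin_num) -> s x \is a fin_num.
  by move=> fx; apply/sum_fin_numP => i _ _; rewrite fin_numM.
exists s; split; last by move=> x /sumE.
split; last first.
  apply: dense_sub (dense_setC_closure hU) => x Nx.
  by apply: sfin => i; apply: generator_fin_num_off.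
move=> x; apply: continuous_sume1 => [j|j k jk].
  by apply: cvgeZl => //; apply: (proj1 (hfD (ZZZ j))).
(* A merged term with coefficient 0 is finite everywhere, as 0 * +oo = 0. *)
have [->|rj] := eqVneq (\sum_(i < n | p i == j) r i)%R 0%R.
  by left; rewrite mul0e.
have [->|rk] := eqVneq (\sum_(i < n | p i == k) r i)%R 0%R.
  by right; rewrite mul0e.
(* A nonzero coefficient is a nonempty sum, so [l] is a value of [p], hence its own
   representative. *)
have imp l : (\sum_(i < n | p i == l) r i)%R != 0%R -> p l = l.
  move=> /eqP hl; have [i /eqP il] : exists i, p i == l.
    apply: contrapT => nl; apply: hl; rewrite big_pred0 // => i.
    by apply/negP => il; apply: nl; exists i.
  by rewrite -[in RHS]il; apply: pE; rewrite -il Zp.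
have [Zj|Zj] := pselect (Z j x); last first.
  by left; rewrite fin_numM // generator_fin_num.
(* If [x] lay in both sets, disjointness would make them equal, and then j = p j = p k = k. *)
right; rewrite fin_numM // generator_fin_num // => Zk.
have Zjk : Z j = Z k by apply: hdisj => //; exists x.
by move/eqP: jk; apply; rewrite -(imp _ rj) -(imp _ rk); apply: pE.
Qed.

(* Elements of D(X) are determined by their values on a dense set, so membership
   in A(X, ZZ) can be tested off [N], where everything is finite. *)
Lemma AXZ_offE h : AXZ ZZ f h <-> DX h /\
  exists (c : X -> R) (n : nat) (r : 'I_n -> R) (Z : 'I_n -> set X),
    [/\ continuous c, forall i, ZZ (Z i) &
      forall x, ~ N x -> h x = (c x)%:E + \sum_(i < n) (r i)%:E * f (Z i) x].
Proof.
split.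
  move=> [_ [s [[c [cc ->]] [Ds [n [r [Z [ZZZ sE]]]]] [_ _ Dh hE]]]].
  split => //; exists c, n, r, Z; split => // x Nx.
  have fx i : f (Z i) x \is a fin_num by exact: generator_fin_num_off.
  rewrite hE //= ?sE //; apply/sum_fin_numP => i _ _.
  by rewrite fin_numM.
move=> [Dh [c [n [r [Z [cc ZZZ hE]]]]]].
have [s [Ds sE]] := exists_Dspan r ZZZ.
exists (EFin \o c), s; split; [by exists c | by split => //; exists n, r, Z |].
split => //; first by apply: CX_DX; exists c.
(* Both sides are continuous, the right one because [c] is finite, so agreement off [N] suffices. *)
suff E : h =1 (EFin \o c) \+ s by move=> x _ _; rewrite E.
apply: (eq_continuous_dense (@ereal_hausdorff R) (proj1 Dh) _ (dense_setC_closure hU)).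
  move=> x; apply: cvgeD; [by []|exact: continuous_EFin|exact: (proj1 Ds)].
move=> x; rewrite inE => Nx; rewrite hE //= sE // => i.
exact: generator_fin_num_off.
Qed.

Lemma AXZ_DX h : AXZ ZZ f h -> DX h.
Proof. by move=> /AXZ_offE[]. Qed.

Lemma AXZ_fin_num h x : AXZ ZZ f h -> ~ N x -> h x \is a fin_num.
Proof.
move=> /AXZ_offE[_ [c [n [r [Z [_ ZZZ hE]]]]]] Nx; rewrite hE //.
rewrite fin_numD /=; apply/sum_fin_numP => i _ _.
by rewrite fin_numM // generator_fin_num_off.
Qed.

Lemma CX_AXZ : CX `<=` AXZ ZZ f.
Proof.
move=> h Ch; apply/AXZ_offE; split; first exact: CX_DX.
case: Ch => c [cc ->]; have e (T : Type) : 'I_0 -> T by case.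
exists c, 0%N, (e R), (e (set X)); split => //; first by case.
by move=> x _; rewrite big_ord0 adde0.
Qed.

Lemma AXZ_scale (r : R) h : AXZ ZZ f h -> AXZ ZZ f (Dscale r h).
Proof.
move=> /AXZ_offE[Dh [c [n [q [Z [cc ZZZ hE]]]]]]; apply/AXZ_offE; split.
  exact: DX_scale.
exists (fun x => r * c x)%R, n, (fun i => r * q i)%R, Z; split => //.
  by move=> x; apply: cvgM; [exact: cvg_cst | exact: cc].
move=> x Nx; rewrite /Dscale hE // muleDr //.
rewrite -EFinM fin_num_sume_distrr //.
  by congr (_ + _); apply: eq_bigr => i _; rewrite EFinM muleA.
move=> i j _ _; rewrite fin_num_adde_defr // fin_numM // generator_fin_num_off //.
Qed.

Lemma AXZ_add g h k : AXZ ZZ f g -> AXZ ZZ f h -> Dsum g h k -> AXZ ZZ f k.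
Proof.
move=> Ag Ah [_ _ Dk kE].
have := Ag; rewrite AXZ_offE => -[_ [c [n [r [Z [cc ZZZ gE]]]]]].
have := Ah; rewrite AXZ_offE => -[_ [d [m [q [W [cd ZZW hE]]]]]].
apply/AXZ_offE; split => //.
exists (fun x => c x + d x)%R, (n + m)%N.
exists (fun i : 'I_(n + m) => match fintype.split i with inl j => r j | inr j => q j end).
exists (fun i : 'I_(n + m) => match fintype.split i with inl j => Z j | inr j => W j end).
split.
- by move=> x; apply: cvgD; [exact: cc | exact: cd].
- by move=> i; case: fintype.split.
- move=> x Nx; rewrite kE ?(AXZ_fin_num Ag) ?(AXZ_fin_num Ah) //.
  rewrite gE // hE // big_split_ord /= EFinD addeACA.
  congr (_ + (_ + _)); apply: eq_bigr => i _.
    by rewrite (unsplitK (inl i)).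
  by rewrite (unsplitK (inr i)).
Qed.


(** * Bands of elements supported in a set *)

Definition restr (K : set X) h : X -> \bar R := fun x => if x \in K then h x else 0.

Definition supported_in (K : set X) : set (X -> \bar R) :=
  [set h | AXZ ZZ f h /\ forall x, ~ K x -> h x = 0].

(** A supremum [s] of elements vanishing off [K] lies above one of them, so it is nonnegative off
    [K]. It also lies below [restr K s], an upper bound that belongs to the lattice by
    hypothesis. *)
Lemma supported_in_band K :
  (forall h, AXZ ZZ f h -> AXZ ZZ f (restr K h)) ->
  vl_band (AXZ ZZ f) (supported_in K).
Proof.
move=> AK; split; [split|].
- by move=> h [].
- by split=> //; apply: CX_AXZ; exact: (CX_cst 0%R).
- move=> g h k [Ag g0] [Ah h0] ghk; split; first exact: AXZ_add ghk.
  move=> x Kx; case: ghk => _ _ _ ->; by rewrite ?g0 ?h0 ?adde0.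
- move=> r h [Ah h0]; split; first exact: AXZ_scale.
  by move=> x Kx; rewrite /Dscale h0 // mule0.
- move=> h g [Ah h0] Ag gh; split => // x Kx.
  have := gh x; rewrite h0 // abse0 => gx.
  by apply/eqP; rewrite -abse_eq0 eq_le gx abse_ge0.
- move=> F s FK [As sub slub]; split => // x Kx.
  (* The empty family has no supremum: it would lie below every constant. *)
  have [[g Fg]|F0] := pselect (exists g, F g); last first.
    have [y [_ sy]] := (proj2 (AXZ_DX As)) setT (ex_intro _ x I) openT.
    have : s y <= (fine (s y) - 1)%:E.
      apply: (slub (EFin \o cst (fine (s y) - 1)%R)) => [|g Fg]; last first.
        by case: F0; exists g.
      by apply: CX_AXZ; exact: CX_cst.
    by rewrite -[X in X <= _]fineK // lee_fin lerBrDl gerDr ler10.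
  apply/eqP; rewrite eq_le; apply/andP; split; last first.
    by rewrite -((FK g Fg).2 x Kx); exact: sub.
  have := slub (restr K s) (AK _ As) _ x; rewrite /restr memNset //; apply.
  move=> h Fh y; case: ifPn => [_|Ky]; first exact: sub.
  by rewrite ((FK h Fh).2 y) // => /mem_set; rewrite (negbTE Ky).
Qed.

(** * Projections onto clopen sets disjoint from [N] *)

Section Clopen.
Context (K : set X).
Hypotheses (clK : clopen K) (KN : K `<=` ~` N).

Lemma restr_CX h : AXZ ZZ f h -> CX (restr K h).
Proof.
move=> Ah; exists (fun x => if x \in K then fine (h x) else 0%R); split.
  apply: (@continuous_glue _ (fine \o h) (cst 0%R)) => // x /set_mem Kx.
    apply: continuous_fine; first by apply: AXZ_fin_num => //; exact: KN.
    exact: (proj1 (AXZ_DX Ah)).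
  exact: cst_continuous.
apply/funext => x; rewrite /restr /=; case: ifPn => // /set_mem Kx.
by rewrite fineK //; apply: AXZ_fin_num => //; exact: KN.
Qed.

(** Off [K] the function [h] may be infinite; writing its restriction there as [h] minus an element
    of C(X) is what puts it in A(X, ZZ). *)
Lemma restrC_Dsum h : AXZ ZZ f h ->
  Dsum h (Dscale (-1) (restr K h)) (restr (~` K) h).
Proof.
move=> Ah; have Dh := AXZ_DX Ah; split => //.
- by apply: DX_scale; apply: CX_DX; exact: restr_CX.
- apply: (DX_restrict Dh).
    apply: (@continuous_glue _ h (cst 0)) => [|x _|x _]; first exact: clopenC.
      exact: (proj1 Dh).
    exact: cst_continuous.
  by move=> x hx; rewrite /restr; case: ifP.
- move=> x hx _; rewrite /restr /Dscale in_setC; case: (x \in K) => /=.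
    by rewrite mulN1e subee.
  by rewrite mule0 adde0.
Qed.

Lemma restrC_AXZ h : AXZ ZZ f h -> AXZ ZZ f (restr (~` K) h).
Proof.
move=> Ah; apply: AXZ_add (restrC_Dsum Ah) => //.
by apply: AXZ_scale; apply: CX_AXZ; exact: restr_CX.
Qed.

Lemma supported_in_projection_band : projection_band (AXZ ZZ f) (supported_in K).
Proof.
split; first by apply: supported_in_band => h Ah; apply: CX_AXZ; exact: restr_CX.
exists (supported_in (~` K)); split.
  by apply: supported_in_band; exact: restrC_AXZ.
split.
  apply/seteqP; split => [h [[Ah h0] [_ h0']]|_ ->] /=.
    apply/funext => x; have [Kx|Kx] := pselect (K x); last exact: h0.
    by apply: h0'.
  have A0 : AXZ ZZ f (cst 0).
    by apply: CX_AXZ; exact: (CX_cst 0%R).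
  by split; split.
move=> h Ah; exists (restr K h), (restr (~` K) h); split.
- split; first by apply: CX_AXZ; exact: restr_CX.
  by move=> x Kx; rewrite /restr memNset.
- split; first exact: restrC_AXZ.
  by move=> x Kx; rewrite /restr memNset.
- split; [apply: CX_DX; exact: restr_CX|apply: AXZ_DX; exact: restrC_AXZ|exact: AXZ_DX|].
  (* At every point one of the two pieces is 0. *)
  move=> x _ _; rewrite /restr in_setC; case: (x \in K) => /=.
    by rewrite adde0.
  by rewrite add0e.
Qed.

(** A real multiple of [g] dominates [h] in absolute value, so solidity of the ideal gives the
    inclusion. *)
Lemma supported_in_sub_ideal (I : set (X -> \bar R)) (g : X -> \bar R) :
  compact [set: X] -> vl_ideal (AXZ ZZ f) I -> I g ->
  (forall x, K x -> g x <> 0) -> supported_in K `<=` I.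
Proof.
move=> hX [IA _ _ IZ Ile] Ig g0 h [Ah h0].
have [u [cu uE]] := restr_CX Ah.
have [v [cv vE]] := restr_CX (IA _ Ig).
(* [w] is the indicator function of [K]. *)
have [w [cw wE]] : CX (restr K (EFin \o cst 1%R)).
  by apply: restr_CX; apply: CX_AXZ; exact: CX_cst.
have uK x : K x -> h x = (u x)%:E.
  by move=> Kx; have := congr1 (@^~ x) uE; rewrite /restr mem_set.
have vK x : K x -> g x = (v x)%:E.
  by move=> Kx; have := congr1 (@^~ x) vE; rewrite /restr mem_set.
have vNK x : ~ K x -> v x = 0%R.
  by move=> Kx; have := congr1 (@^~ x) vE; rewrite /restr memNset //= => -[].
have wK x : K x -> w x = 1%R.
  by move=> Kx; have := congr1 (@^~ x) wE; rewrite /restr mem_set //= => -[].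
have wNK x : ~ K x -> w x = 0%R.
  by move=> Kx; have := congr1 (@^~ x) wE; rewrite /restr memNset //= => -[].
(* [d] is v on K and 1 off K, so that the quotient u / d is continuous on X. *)
pose d x := (v x + (1 - w x))%R.
have d0 x : d x != 0%R.
  rewrite /d; have [Kx|Kx] := pselect (K x).
    rewrite wK // subrr addr0; apply/eqP => vx.
    by apply: (g0 x Kx); rewrite vK // vx.
  by rewrite wNK // vNK // subr0 add0r oner_eq0.
have cq : continuous (fun x => u x / d x)%R.
  move=> x; apply: cvgM; first exact: cu.
  apply: cvgV => //; apply: cvgD; first exact: cv.
  by apply: cvgB; [exact: cvg_cst | exact: cw].
have /compact_bounded[M [_ Mb]] : compact [set (u x / d x)%R | x in [set: X]].
  by apply: continuous_compact => //; exact: continuous_subspaceT.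
(* The bound holds for every real strictly above [M]; the absolute value keeps [m] nonnegative. *)
pose m := (`|M| + 1)%R.
apply: (Ile (Dscale m g)) => //; first exact: IZ.
move=> x; have [Kx|Kx] := pselect (K x); last by rewrite h0 // abse0 abse_ge0.
have := Mb m _ (u x / d x)%R _; rewrite /Dscale uK // vK // -EFinM.
have dE : d x = v x by rewrite /d wK // subrr addr0.
rewrite dE.
have vx : v x != 0%R.
  by apply/eqP => vx; apply: (g0 x Kx); rewrite vK // vx.
rewrite /= lee_fin normrM normfV ler_pdivrMr ?normr_gt0 // normrM.
have m0 : (0 <= m)%R by rewrite addr_ge0.
rewrite (ger0_norm m0); apply; last by exists x; rewrite // dE.
by rewrite /m (le_lt_trans (ler_norm M)) // ltrDl.
Qed.

End Clopen.
End Space.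
End ExtendedFunctions.

(** * Sufficiently many projections *)

Theorem theorem8p1 (R : realType) (X : topologicalType)
    (hX : compact [set: X]) (hH : hausdorff_space X)
    (ZZ : set (set X)) (f : set X -> X -> \bar R)
    (hdisj : trivIset ZZ id)
    (hne : forall Z, ZZ Z -> Z !=set0)
    (hnd : forall Z, ZZ Z -> nowhere_dense Z)
    (hzero : forall Z, ZZ Z -> zero_set R Z)
    (hfD : forall Z, ZZ Z -> DX (f Z))
    (hf1 : forall Z, ZZ Z -> forall x, 1 <= f Z x)
    (hfZ : forall Z, ZZ Z -> f Z @^-1` [set +oo] = Z)
    (hpi : piZD X)
    (hU : nowhere_dense (\bigcup_(Z in ZZ) Z)) :
  SMP (AXZ ZZ f).
Proof.
move=> B [idB supB] [g Bg g0].
have Ag : AXZ ZZ f g by case: idB => + _ _ _ _; apply.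
have [x gx] : exists x, g x <> 0.
  apply: contrapT => h; apply: g0; apply/funext => x.
  by apply: contrapT => gx; apply: h; exists x.
have oU : open [set x | g x != 0].
  rewrite (_ : [set x | _] = g @^-1` (~` [set 0])); last first.
    by apply/seteqP; split => y /= /eqP.
  apply: open_comp; first by move=> y _; exact: (proj1 (AXZ_DX hdisj hfD hf1 hfZ hU Ag)).
  rewrite openC; apply: compact_closed; [exact: ereal_hausdorff | exact: compact_set1].
have /hpi[] := openI oU (closed_openC (@closed_closure _ (\bigcup_(Z in ZZ) Z))).
  by apply: (dense_setC_closure hU) => //; exists x; apply/eqP.
move=> K [clK [y Ky] KU].
have KN : K `<=` ~` closure (\bigcup_(Z in ZZ) Z) by move=> z /KU[].
exists (supported_in ZZ f K); split.
- exact: supported_in_projection_band.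
(* The indicator of [K] is a nonzero element: its value at [y] is 1. *)
- exists (restr K (EFin \o cst 1%R)).
    split; last by move=> z Kz; rewrite /restr memNset.
    apply: CX_AXZ => //; apply: (@restr_CX R X ZZ f) => //.
    by apply: CX_AXZ => //; exact: CX_cst.
  move=> /(congr1 (@^~ y)); rewrite /restr mem_set //= => -[] /eqP.
  by rewrite oner_eq0.
- apply: (supported_in_sub_ideal hdisj hfD hf1 hfZ hU clK KN hX idB Bg).
  by move=> z /KU[/eqP].
Qed.
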